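(* Let $n\ge1$, $m\ge0$ be integers and $\epsilon\in\{0,1\}$. For real $z>0$, $$\int_0^1 t^{z-1} f^{\epsilon}_{m,n}(t)\,dt=\frac{1}{z+2m+1+\epsilon}+(-1)^{n+1}\frac{(-m-\frac12)_{n+1}}{(m+1+\epsilon)_{n+1}(n+1)(2n+1+2\epsilon)}$$ $$+(-1)^n\,\frac{\frac{z+\epsilon}{2}+m+\frac12+(n+1)(n+\frac12+\epsilon)}{\bigl(\frac{z+\epsilon}{2}+m+\frac12\bigr)(n+1)(2n+1+2\epsilon)}\;\frac{(-m-\frac12)_{n+1}\,\bigl(-\frac{z-\epsilon}{2}+\frac12\bigr)_{n+1}}{(m+1+\epsilon)_{n+1}\,\bigl(-n-\frac{z+\epsilon}{2}\bigr)_{n+1}} .$$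
   Context: $(a)_0=1$, $(a)_j=a(a+1)\cdots(a+j-1)$ for $j\ge1$; ${}_pF_q\left({a_1,\dots,a_p\atop b_1,\dots,b_q};t\right)=\sum_{i\ge0}\frac{(a_1)_i\cdots(a_p)_i}{(b_1)_i\cdots(b_q)_i\,i!}t^i$. The polynomial $f^\epsilon_{m,n}$ is $$f^{\epsilon}_{m,n}(t)= t^{\epsilon}\,\frac{(\frac12+\epsilon)_{n}\,\bigl(n^2+(\frac32+\epsilon)n+m+1+\epsilon\bigr)\,(-m+\frac12)_{n}}{(m+1+\epsilon)_{n+1}\,(n+1)!}\;{}_4F_3\!\left({-n,\ -n^2-(\frac32+\epsilon)n-m-\epsilon,\ -m-\frac12,\ n+\frac32+\epsilon \atop \frac12+\epsilon,\ -n^2-(\frac32+\epsilon)n-m-1-\epsilon,\ -m+\frac12};\,t^2\right).$$ *)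

(* Defs.v *)
From HB Require Import structures.
From mathcomp Require Import all_boot all_order all_algebra.
From mathcomp Require Import all_classical all_reals all_analysis.
Import Order.TTheory GRing.Theory Num.Theory.
Import numFieldNormedType.Exports.

Set Implicit Arguments.
Unset Strict Implicit.
Unset Printing Implicit Defensive.

Local Open Scope ring_scope.
Local Open Scope classical_set_scope.

(* Pochhammer symbol (a)_j = a (a + 1) ... (a + j - 1). *)
Definition poch (R : realType) (a : R) (j : nat) : R :=
  \prod_(i < j) (a + i%:R).

Definition hyp_term (R : realType) (a b : seq R) (t : R) (i : nat) : R :=
  (\prod_(x <- a) poch x i) / ((\prod_(y <- b) poch y i) * i`!%:R) * t ^+ i.

(* pFq(a; b; t), with p = size a and q = size b.  When an upper parameter is
   -n, every term with i > n is 0, including those whose denominator vanishes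
   as well, since x / 0 = 0: the series is then the usual terminating sum. *)
Definition hyp (R : realType) (a b : seq R) (t : R) : R :=
  limn (series (hyp_term a b t)).

(* f^e_{m,n}(t), meant for e = 0 and e = 1. *)
Definition fmn (R : realType) (e m n : nat) (t : R) : R :=
  t ^+ e *
  ((poch (1 / 2 + e%:R) n *
    (n%:R ^+ 2 + (3 / 2 + e%:R) * n%:R + m%:R + 1 + e%:R) *
    poch (- m%:R + 1 / 2) n) /
   (poch (m%:R + 1 + e%:R) n.+1 * (n.+1)`!%:R)) *
  hyp [:: - n%:R;
          - n%:R ^+ 2 - (3 / 2 + e%:R) * n%:R - m%:R - e%:R;
          - m%:R - 1 / 2;
          n%:R + 3 / 2 + e%:R]
      [:: 1 / 2 + e%:R;
          - n%:R ^+ 2 - (3 / 2 + e%:R) * n%:R - m%:R - 1 - e%:R;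
          - m%:R + 1 / 2]
      (t ^+ 2).

(* Main.v *)
(* The integral of [f] is a finite sum of simple fractions in [w = (z + e) / 2],
   with poles [0, -1, ..., -n].  Put [al = e + 1/2], [mu = m + 1/2] and
   [a = (n + 1) (n + al)].  With [Q = prod_i (X + i)] and
   [S = prod_i (X - al - i)], the right-hand side is
     [(Q / 2 + B ((X + mu + a) S - (X + mu) Q)) / ((X + mu) Q)]  at  [w],
   where the constant [B] is such that the numerator vanishes at [- mu].  Its
   degree is at most [n + 1], since [(X + mu + a) S] and [(X + mu) Q] are
   monic; the quotient by [X + mu] therefore has degree at most
   [n], and Lagrange interpolation at [0, -1, ..., -n] gives its partial
   fractions, whose coefficients are those of the hypergeometric sum. *)
Require Import Defs.
From HB Require Import structures.
From mathcomp Require Import all_boot all_order all_algebra.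
From mathcomp Require Import all_classical all_reals all_analysis.
From mathcomp Require Import measurable_realfun ring lra.
Import Order.TTheory GRing.Theory Num.Theory.
Import numFieldNormedType.Exports.

Set Implicit Arguments.
Unset Strict Implicit.
Unset Printing Implicit Defensive.

Local Open Scope ring_scope.
Local Open Scope classical_set_scope.

(** * Integrals of real powers over the unit interval *)

Lemma integral_powR_cc (R : realType) (s a : R) : 0 < s -> 0 < a -> a < 1 ->
  (\int[@lebesgue_measure R]_(t in `[a, 1%R]) (t `^ (s - 1))%:E
   = ((1 - a `^ s) / s)%:E)%E.
Proof.
move=> s0 a0 a1.
have s_neq0 : s != 0 by rewrite gt_eqF.
have dpow (p x : R) : 0 < x -> derivable (fun y : R => y `^ p) x 1.
  by move=> x0; apply: derivable_powR; rewrite in_itv/= x0.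
have cpow (p x : R) : 0 < x -> {for x, continuous (fun y : R => y `^ p)}.
  by move=> x0; apply: differentiable_continuous; apply/derivable1_diffP/dpow.
rewrite (@continuous_FTC2 _ _ (fun x : R => s^-1 * x `^ s))//.
- rewrite -EFinB powR1; congr EFin; field => //.
- apply: continuous_in_subspaceT => x; rewrite inE/= in_itv/= => /andP[ax _].
  by apply: cpow; exact: lt_le_trans ax.
- have cF (x : R) : 0 < x -> {for x, continuous (fun x : R => s^-1 * x `^ s)}.
    by move=> x0; apply: cvgMr; exact: cpow.
  split => [x||].
  + rewrite in_itv/= => /andP[ax _].
    by apply: derivableM; [exact: derivable_cst | exact/dpow/(lt_trans a0)].
  + by apply: cvg_at_right_filter; exact: cF.
  + by apply: cvg_at_left_filter; exact: cF.
- move=> x; rewrite in_itv/= => /andP[ax _].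
  have x0 : 0 < x by exact: lt_trans ax.
  rewrite derive1E deriveM//=; last exact: dpow.
  rewrite derive_cst scaler0 addr0 -derive1E powR_derive1 ?in_itv/= ?x0//.
  by rewrite /GRing.scale/= mulKf.
Qed.

(** For [s < 1] the integrand is unbounded near 0, so the fundamental theorem of calculus is used
    only on [[1 / (k + 2), 1]]. These intervals increase to []0, 1]], and monotone convergence
    applies, since [a ^ s] tends to 0 as [a] decreases to 0. *)
Lemma integral_powR01 (R : realType) (s : R) : 0 < s ->
  (\int[@lebesgue_measure R]_(t in `[0%R, 1%R]) (t `^ (s - 1))%:E
   = (s^-1)%:E)%E.
Proof.
move=> s0.
have mpow (D : set R) : measurable_fun D (fun t : R => (t `^ (s - 1))%:E).
  by apply/measurable_EFinP; exact: measurable_funTS.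
rewrite -integral_itv_obnd_cbnd; last exact: mpow.
(* The shift by 2 keeps the left endpoint strictly below 1, as [integral_powR_cc] requires. *)
pose F (k : nat) : set R := `[k.+2%:R^-1, 1%R].
have FE : \bigcup_k F k = `]0, 1].
  apply/seteqP; split => x /=.
    move=> [k _]; rewrite /F/= !in_itv/= => /andP[kx ->].
    by rewrite andbT (lt_le_trans _ kx)// invr_gt0 ltr0n.
  rewrite in_itv/= => /andP[x0 x1].
  have [k kx] := ltr_add_invr x0.
  exists k => //; rewrite /F/= in_itv/= x1 andbT ltW// (le_lt_trans _ kx)//.
  by rewrite add0r lef_pV2 ?posrE ?ltr0n// ler_nat.
rewrite -FE.
have cvgI : ((1 - k.+2%:R^-1 `^ s) / s)%:E @[k --> \oo] --> (s^-1)%:E.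
  suff : ((1 - k.+2%:R^-1 `^ s) / s)%:E @[k --> \oo] --> ((1 - 0) / s)%:E.
    by rewrite subr0 mul1r.
  apply: cvg_EFin; first exact: nearW.
  apply: cvgMl; apply: cvgB; first exact: cvg_cst.
  suff : (fun a : R => a `^ s) (k.+2%:R^-1) @[k --> \oo] --> (0 : R) by [].
  apply: (cvg_comp _ _ _ (powR_cvg0 s0)) => A [eps /= e0 epsA].
  have [k kx] := ltr_add_invr e0.
  exists k => // j /= kj; apply: epsA => /=; last by rewrite invr_gt0 ltr0n.
  rewrite sub0r normrN gtr0_norm ?invr_gt0 ?ltr0n// (le_lt_trans _ kx)// add0r.
  by rewrite lef_pV2 ?posrE ?ltr0n// ler_nat ltnS (leq_trans kj).
have cvgF := @ge0_nondecreasing_set_cvg_integral _ (measurableTypeR R) R F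
  (fun t => (t `^ (s - 1))%:E) lebesgue_measure.
apply: (cvg_unique _ (cvgF _ _ _ _)) => //.
- apply/nondecreasing_seqP => k; rewrite subsetEset; apply: subset_itvr.
  by rewrite bnd_simp lef_pV2 ?posrE ?ltr0n// ler_nat.
- by move=> k; exact: measurable_itv.
- by move=> k; exact: mpow.
- by move=> k x _; rewrite lee_fin powR_ge0.
have -> : (fun k => \int[lebesgue_measure]_(x in F k) (x `^ (s - 1))%:E)%E =
          (fun k => ((1 - k.+2%:R^-1 `^ s) / s)%:E).
  apply/funext => k; apply: integral_powR_cc => //.
  by rewrite invf_lt1 ?ltr0n// ltr1n.
by [].
Qed.

(** * Termination of the series and termwise integration *)

Lemma poch_oppr_eq0 (R : realType) (n i : nat) :
  (n < i)%N -> poch (- n%:R : R) i = 0.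
Proof.
by move=> ni; rewrite /poch (bigD1 (Ordinal ni))//= addNr mul0r.
Qed.

(** Beyond index [n] the factor [(-n)_i] of the numerator is 0 whatever the denominator is, so the
    partial sums are constant from rank [n + 1] on. *)
Lemma hyp_terminating (R : realType) (n : nat) (a b : seq R) (t : R) :
  hyp (- n%:R :: a) b t = \sum_(i < n.+1) hyp_term (- n%:R :: a) b t i.
Proof.
apply/cvg_lim => //; apply: cvg_near_cst; exists n.+1 => // k /= nk.
rewrite /series/= (@big_cat_nat _ _ _ n.+1)//= big_mkord.
rewrite [X in _ + X]big_nat_cond [X in _ + X]big1 ?addr0// => i.
rewrite andbT => /andP[ni _].
by rewrite /hyp_term big_cons poch_oppr_eq0// !mul0r.
Qed.

Lemma integral_powR_polynomial (R : realType) (z : R) (N : nat) (c : 'I_N -> R)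
    (d : 'I_N -> nat) : 0 < z ->
  (\int[@lebesgue_measure R]_(t in `[0%R, 1%R])
     (t `^ (z - 1) * \sum_(i < N) c i * t ^+ d i)%:E
   = (\sum_(i < N) c i / (z + (d i)%:R))%:E)%E.
Proof.
move=> z0.
have zd0 i : 0 < z + (d i)%:R by rewrite ltr_wpDr.
have mpow (s : R) (D : set R) : measurable_fun D (fun t : R => (t `^ s)%:E).
  by apply/measurable_EFinP; exact: measurable_funTS.
have ipow i : (@lebesgue_measure R).-integrable `[0%R, 1%R]
    (fun t : R => (t `^ (z + (d i)%:R - 1))%:E).
  apply/integrableP; split; first exact: mpow.
  under eq_integral do rewrite gee0_abs ?lee_fin ?powR_ge0//.
  by rewrite integral_powR01// ltry.
transitivity (\int[@lebesgue_measure R]_(t in `[0%R, 1%R])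
    (\sum_(i < N) (c i)%:E * (t `^ (z + (d i)%:R - 1))%:E)%E)%E; last first.
  rewrite integral_sum//; last by move=> i; exact: integrableZl.
  rewrite -sumEFin; apply: eq_bigr => i _.
  by rewrite integralZl// integral_powR01// EFinM.
have sE (t : R) : (\sum_(i < N) (c i)%:E * (t `^ (z + (d i)%:R - 1))%:E =
    (\sum_(i < N) c i * t `^ (z + (d i)%:R - 1))%:E)%E.
  by rewrite -sumEFin.
under [in RHS]eq_integral do rewrite sE.
(* Dropping the endpoint 0 makes the base nonzero, which discharges the side condition of [powRD]
   when the two powers of [t] are merged. *)
rewrite -!integral_itv_obnd_cbnd.
- apply: eq_integral => t; rewrite inE/= in_itv/= => /andP[t0 _].
  congr EFin; rewrite mulr_sumr; apply: eq_bigr => i _.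
  rewrite mulrCA -(powR_mulrn _ (ltW t0)) -powRD ?(gt_eqF t0) ?implybT//.
  by rewrite addrAC.
- apply/measurable_EFinP; apply: measurable_sum => i.
  by apply: measurable_funM => //; exact: measurable_funTS.
- apply/measurable_EFinP; apply: measurable_funM; first exact: measurable_funTS.
  apply: measurable_sum => i; apply: measurable_funM => //.
Qed.

(** * Pochhammer identities and the hypergeometric coefficients *)

Lemma poch0 (R : realType) (a : R) : poch a 0 = 1.
Proof. by rewrite /poch big_ord0. Qed.

Lemma pochSr (R : realType) (a : R) n : poch a n.+1 = poch a n * (a + n%:R).
Proof. by rewrite /poch big_ord_recr. Qed.

Lemma pochD (R : realType) (a : R) m n :
  poch a (m + n) = poch a m * poch (a + m%:R) n.
Proof.
elim: n => [|n ih]; first by rewrite addn0 poch0 mulr1.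
by rewrite addnS !pochSr ih -mulrA natrD addrA.
Qed.

Lemma pochS (R : realType) (a : R) n : poch a n.+1 = a * poch (a + 1) n.
Proof. by rewrite -add1n pochD pochSr poch0 addr0 mul1r. Qed.

Lemma poch_neq0 (R : realType) (a : R) n :
  (forall i, (i < n)%N -> a + i%:R != 0) -> poch a n != 0.
Proof. by move=> an; apply/prodf_neq0 => i _; exact: an. Qed.

Lemma prod_opp (R : realType) (f : nat -> R) n :
  \prod_(i < n) - f i = (-1) ^+ n * \prod_(i < n) f i.
Proof. by rewrite prodrN card_ord. Qed.

(** Reversing the order of the factors turns each one into the opposite of a factor of
    [(a)_{n+1}]. *)
Lemma poch_oppD (R : realType) (a : R) n :
  poch (- n%:R - a) n.+1 = (-1) ^+ n.+1 * poch a n.+1.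
Proof.
rewrite /poch -(prod_opp (fun i => a + i%:R)) (reindex_inj rev_ord_inj)/=.
apply: eq_bigr => i _; rewrite subSS natrB; first by ring.
by rewrite -ltnS.
Qed.

Lemma poch_natN (R : realType) n i : (i <= n)%N ->
  poch (- n%:R : R) i * (n - i)`!%:R = (-1) ^+ i * n`!%:R.
Proof.
elim: i => [_|i ih lin]; first by rewrite poch0 subn0.
rewrite pochSr exprS -[in RHS]mulrA -ih 1?ltnW//.
rewrite (_ : (n - i = (n - i.+1).+1)%N); last by rewrite subnSK.
rewrite factS natrM subnSK// natrB; last exact: ltnW.
by move: (_`!%:R) (poch _ _) => x y; ring.
Qed.

(** The product is the Lagrange denominator at the node [- i] among [0, ..., - n]. Its factors with
    [j < i] form [(-i)_i = (-1)^i i!], those with [j > i] form [(n - i)!]; the sign and [(n - i)!]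
    cancel against [(-n)_i]. *)
Lemma poch_lagrange_denominator (R : realType) n i : (i <= n)%N ->
  poch (- n%:R : R) i * \prod_(j < n.+1 | j != i :> nat) (j%:R - i%:R) =
  i`!%:R * n`!%:R.
Proof.
move=> lein; have -> : \prod_(j < n.+1 | j != i :> nat) (j%:R - i%:R) =
    (-1) ^+ i * i`!%:R * (n - i)`!%:R :> R.
  rewrite -(big_mkord (fun j => j != i) (fun j => j%:R - i%:R)).
  rewrite (@big_cat_nat _ _ _ i)//=; last exact: leqW.
  congr (_ * _).
    rewrite -[RHS]poch_natN// subnn mulr1 big_mkord /poch.
    rewrite big_mkcond/=; apply: eq_bigr => j _.
    by rewrite ltn_eqF// addrC.
  rewrite big_ltn_cond// eqxx/= big_add1/= -{1}(add0n i) big_addn big_mkord.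
  rewrite big_mkcond fact_prod natr_prod big_add1/= big_mkord.
  apply: eq_bigr => j _.
  by rewrite gtn_eqF ?ltnS ?leq_addl// -addSn natrD addrK.
by rewrite mulrCA mulrC poch_natN// mulrACA -expr2 sqrr_sign mul1r mulrC.
Qed.

(** This matches the [i]-th hypergeometric coefficient with the Lagrange coefficient at the node
    [- i], cleared of denominators. Two pairs of parameters differ by 1, so their quotients
    collapse: [(L + 1)_i / (L)_i = (L + i) / L] and [(-mu)_i / (1 - mu)_i = mu / (mu - i)]. *)
Lemma terminating_hyp_coef (R : realType) (al mu M : R) (n i : nat)
    (L := - ((n%:R + 1) * (n%:R + al) + mu)) :
  (i <= n)%N -> 0 < al -> M != 0 ->
  (forall j, (j <= n)%N -> mu != j%:R) -> 0 < mu ->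
  poch al n * - L * poch (1 - mu) n / (M * (n.+1)`!%:R) *
  ((poch (- n%:R) i * poch (L + 1) i * poch (- mu) i * poch (n%:R + 1 + al) i) /
   (poch al i * poch L i * poch (1 - mu) i * i`!%:R)) / 2 *
  (mu - i%:R) * \prod_(j < n.+1 | j != i :> nat) (j%:R - i%:R) =
  poch (- mu) n.+1 / (M * (n%:R + 1) * (2 * (n%:R + al))) * (L + i%:R) *
  poch (al + i%:R) n.+1.
Proof.
move=> lein al0 M0 mun mu0.
have n0 : 0 <= n%:R :> R := ler0n _ n.
have nal0 : 0 < n%:R + al by lra.
(* Since [(n + 1) (n + al) + mu > n], no factor of [(L)_i] vanishes. *)
have Lj j : (j <= n)%N -> L + j%:R < 0.
  by rewrite -(ler_nat R) /L => ?; nra.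
have L0 : L != 0 by have := Lj 0%N isT; rewrite addr0 => /lt_eqF ->.
have al_neq0 : poch al i != 0.
  by apply: poch_neq0 => j _; rewrite gt_eqF// ltr_wpDr.
have L_neq0 : poch L i != 0.
  by apply: poch_neq0 => j ji; rewrite lt_eqF// Lj// (leq_trans (ltnW ji)).
have mu_neq0 : poch (1 - mu) i != 0.
  apply: poch_neq0 => j ji; apply: contraNneq (mun j.+1 (leq_trans ji lein)).
  by rewrite -natr1 => mujE; apply/eqP; lra.
have mui : i%:R - mu != 0 by rewrite subr_eq0 eq_sym mun.
have n1 : n%:R + 1 != 0 :> R by rewrite natr1 pnatr_eq0.
have eL : poch (L + 1) i = poch L i * (L + i%:R) / L.
  by rewrite -pochSr pochS mulrC mulKf.
have emu : poch (- mu) i = - mu * poch (1 - mu) i / (i%:R - mu).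
  by rewrite (addrC 1) -pochS pochSr (addrC i%:R) mulfK// addrC.
(* Both sides come from splitting [(al)_{n+1+i}], at [i] or at [n + 1]. *)
have epai : poch (al + i%:R) n.+1 =
    poch al n * (n%:R + al) * poch (n%:R + 1 + al) i / poch al i.
  apply: (canRL (mulfK al_neq0)); rewrite mulrC -pochD addnC pochD pochSr.
  by rewrite (addrC al n%:R) natr1 (addrC al).
have facn_neq0 k : k`!%:R != 0 :> R by rewrite pnatr_eq0 -lt0n fact_gt0.
have eden := poch_lagrange_denominator R lein.
have pN_neq0 : poch (- n%:R : R) i != 0.
  apply: contraNneq (mulf_neq0 (facn_neq0 i) (facn_neq0 n)) => pN0.
  by rewrite -eden pN0 mul0r.
have {}eden := canRL (mulKf pN_neq0) eden.
have emun : poch (- mu) n.+1 = - mu * poch (1 - mu) n.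
  by rewrite pochS addrC.
rewrite eden eL emu emun epai factS natrM -natr1.
(* Pochhammer symbols, factorials and [L] become variables, which leaves a rational identity for
   [field]. *)
move: (facn_neq0 i) (facn_neq0 n) => {facn_neq0 eden emun epai emu eL Lj mun}.
move: i`!%:R n`!%:R (poch (- n%:R) i) pN_neq0 => fi fn pN pN_neq0 fi0 fn0.
move: (poch al i) (poch L i) (poch (1 - mu) i) al_neq0 L_neq0 mu_neq0.
move=> pal pL pmu pal0 pL0 pmu0; move: (poch _ _) (poch _ _) (poch _ _).
move=> x1 x2 x3; rewrite -/L.
move: L L0 n0 nal0 n1 mui => L' L0 n0 nal0 n1 mui.
by field; rewrite mui n1 L0 (gt_eqF nal0) fi0 fn0 pN_neq0 pal0 pL0 pmu0 M0.
Qed.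

(** * Lagrange interpolation and partial fractions *)

Lemma size_sub_monic (F : nzRingType) (p q : {poly F}) :
  p \is monic -> q \is monic -> size p = size q -> (size (p - q)%R < size p)%N.
Proof.
move=> pm qm pq; have p0 : (0 < size p)%N by rewrite size_poly_gt0 monic_neq0.
rewrite -[X in (_ < X)%N]prednK// ltnS; apply/leq_sizeP => j.
rewrite leq_eqVlt coefB => /predU1P[<-|].
  by rewrite -lead_coefE (monicP pm) pq -lead_coefE (monicP qm) subrr.
rewrite prednK// => pj; rewrite !nth_default ?subrr// -?pq//.
Qed.

Lemma size_prod_XsubC_ord (F : nzRingType) N (x : 'I_N -> F) :
  size (\prod_i ('X - (x i)%:P)) = N.+1.
Proof. by rewrite size_prod_XsubC [index_enum _]unlock -enumT size_enum_ord. Qed.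

(** The polynomial [p] equals its interpolant [q], as [p - q] has size at most [N] and [N] distinct
    roots. Dividing [q] by the full product leaves one simple fraction per node. *)
Lemma lagrange_partial_fraction (F : fieldType) N (x : 'I_N -> F)
    (p : {poly F}) (w : F) :
  (size p <= N)%N -> injective x -> (forall i, w != x i) ->
  p.[w] / \prod_i (w - x i) =
  \sum_i p.[x i] / \prod_(j | j != i) (x i - x j) / (w - x i).
Proof.
move=> pN xI wx.
pose den i := \prod_(j | j != i) (x i - x j).
pose l i := \prod_(j | j != i) ('X - (x j)%:P).
pose q := \sum_i (p.[x i] / den i) *: l i.
have den0 i : den i != 0.
  by apply/prodf_neq0 => j ji; rewrite subr_eq0 (inj_eq xI) eq_sym.
have lE i y : (l i).[y] = \prod_(j | j != i) (y - x j).
  by rewrite horner_prod; apply: eq_bigr => j _; rewrite hornerXsubC.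
have sizel i : (size (l i) <= N)%N.
  have := size_prod_XsubC_ord x; rewrite (bigD1 i)//= size_monicM ?monicXsubC//.
    by rewrite size_XsubC => -[lN]; apply: eq_leq.
  by apply/prodf_neq0 => j _; rewrite polyXsubC_eq0.
have pq : p = q.
  apply/eqP; rewrite -subr_eq0; apply/eqP.
  apply: (@roots_geq_poly_eq0 _ _ [seq x i | i <- enum 'I_N]).
  - apply/allP => _ /mapP[i _ ->]; rewrite /root hornerD hornerN horner_sum.
    rewrite (bigD1 i)//= big1 => [|j ji].
      by rewrite hornerZ lE divfK// addr0 subrr.
    by rewrite hornerZ lE (bigD1 i) 1?eq_sym//= subrr mul0r mulr0.
  - by rewrite map_inj_uniq ?enum_uniq.
  - rewrite size_map size_enum_ord (leq_trans (size_polyD _ _))// geq_max pN/=.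
    rewrite size_polyN (leq_trans (size_sum _ _ _))//.
    by apply/bigmax_leqP => i _; rewrite (leq_trans (size_scale_leq _ _)).
rewrite [in LHS]pq horner_sum mulr_suml; apply: eq_bigr => i _.
rewrite hornerZ lE -mulrA; congr (_ * _).
rewrite [X in _ / X](bigD1 i)//= invfM mulrCA divff ?mulr1//.
by apply/prodf_neq0 => j _; rewrite subr_eq0.
Qed.

(** The last hypothesis makes the pole at [- mu] removable, so only the poles [x i] remain. The
    first product vanishes there, which is why [c] is absent from the residues. *)
Lemma partial_fraction_shifted (F : fieldType) N (x y : 'I_N -> F)
    (a c B mu w : F) :
  injective x -> (forall i, w != x i) -> w != - mu ->
  (forall i, x i != - mu) ->
  c * \prod_i (- mu - x i) + B * a * \prod_i (- mu - y i) = 0 ->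
  c / (w + mu) + B * ((w + mu + a) / (w + mu) *
     (\prod_i (w - y i) / \prod_i (w - x i)) - 1) =
  \sum_i B * (x i + mu + a) * \prod_j (x i - y j) / (x i + mu) /
    \prod_(j | j != i) (x i - x j) / (w - x i).
Proof.
move=> xI wx wmu xmu mu0.
pose Q := \prod_i ('X - (x i)%:P).
pose S := \prod_i ('X - (y i)%:P).
pose p := c *: Q + B *: (('X - (- mu - a)%:P) * S - ('X - (- mu)%:P) * Q).
have QE z : Q.[z] = \prod_i (z - x i).
  by rewrite horner_prod; apply: eq_bigr => j _; rewrite hornerXsubC.
have SE z : S.[z] = \prod_i (z - y i).
  by rewrite horner_prod; apply: eq_bigr => j _; rewrite hornerXsubC.
have Qm : Q \is monic by exact: monic_prod_XsubC.
have Sm : S \is monic by exact: monic_prod_XsubC.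
have sizeXS z : size (('X - z%:P) * S) = N.+2.
  by rewrite size_monicM ?monicXsubC ?monic_neq0// size_XsubC size_prod_XsubC_ord.
have sizeXQ z : size (('X - z%:P) * Q) = N.+2.
  by rewrite size_monicM ?monicXsubC ?monic_neq0// size_XsubC size_prod_XsubC_ord.
have sizep : (size p <= N.+1)%N.
  rewrite (leq_trans (size_polyD _ _))// geq_max; apply/andP; split.
    by rewrite (leq_trans (size_scale_leq _ _))// size_prod_XsubC_ord.
  rewrite (leq_trans (size_scale_leq _ _))// -ltnS -(sizeXS (- mu - a)).
  by apply: size_sub_monic; rewrite ?sizeXS ?sizeXQ// monicMl ?monicXsubC.
have pE z : p.[z] = c * \prod_i (z - x i) + B *
    ((z + mu + a) * \prod_i (z - y i) - (z + mu) * \prod_i (z - x i)).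
  rewrite hornerD !hornerZ hornerD hornerN !hornerM !hornerXsubC QE SE; ring.
have /factor_theorem[g gE] : root p (- mu).
  by rewrite /root pE addNr add0r mul0r subr0 mulrA mu0.
have g0E z : z != - mu -> g.[z] = p.[z] / (z + mu).
  move=> zmu; rewrite gE hornerM hornerXsubC opprK mulfK//.
  by rewrite addr_eq0.
have sizeg : (size g <= N)%N.
  have [->|g0] := eqVneq g 0; first by rewrite size_poly0.
  by move: sizep; rewrite gE size_Mmonic ?monicXsubC// size_XsubC addn2.
have := lagrange_partial_fraction sizeg xI wx.
have Qw0 : \prod_i (w - x i) != 0.
  by apply/prodf_neq0 => j _; rewrite subr_eq0.
have wmu0 : w + mu != 0 by rewrite addr_eq0.
rewrite g0E// pE => gw.
transitivity (\sum_i g.[x i] / \prod_(j | j != i) (x i - x j) / (w - x i)).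
  by rewrite -gw; field; rewrite Qw0.
apply: eq_bigr => i _; rewrite g0E// pE (bigD1 i)//= subrr mul0r !mulr0.
by rewrite add0r subr0 mulrA.
Qed.

(** This applies [partial_fraction_shifted] with nodes [- i], zeros [al + k], [c = 1 / 2] and
    [B = (-1)^n b]; the residues are then identified by [terminating_hyp_coef]. *)
Lemma terminating_hyp_partial_fraction (R : realType) (n : nat)
    (al mu w : R) (L := - ((n%:R + 1) * (n%:R + al) + mu))
    (b := poch (- mu) n.+1 /
          (poch (mu + al) n.+1 * (n%:R + 1) * (2 * (n%:R + al)))) :
  0 < al -> 0 < mu -> 0 < w -> (forall j, (j <= n)%N -> mu != j%:R) ->
  \sum_(i < n.+1)
    poch al n * - L * poch (1 - mu) n / (poch (mu + al) n.+1 * (n.+1)`!%:R) *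
    ((poch (- n%:R) i * poch (L + 1) i * poch (- mu) i *
      poch (n%:R + 1 + al) i) /
     (poch al i * poch L i * poch (1 - mu) i * i`!%:R)) / 2 / (w + i%:R) =
  1 / 2 / (w + mu) - (-1) ^+ n * b + (-1) ^+ n * b *
    ((w + mu + (n%:R + 1) * (n%:R + al)) / (w + mu)) *
    (poch (al - w) n.+1 / poch (- n%:R - w) n.+1).
Proof.
move=> al0 mu0 w0 mun.
have n0 : 0 <= n%:R :> R := ler0n _ n.
have M0 : poch (mu + al) n.+1 != 0.
  by apply: poch_neq0 => j _; rewrite gt_eqF// ltr_wpDr// addr_gt0.
pose x (i : 'I_n.+1) : R := - i%:R.
pose y (k : 'I_n.+1) : R := al + k%:R.
have xI : injective x.
  by move=> i j /oppr_inj/eqP; rewrite eqr_nat => /eqP/val_inj.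
have prodx u : \prod_i (u - x i) = poch u n.+1.
  by apply: eq_bigr => i _; rewrite opprK.
have prody u : \prod_i (u - y i) = (-1) ^+ n.+1 * poch (al - u) n.+1.
  rewrite -(prod_opp (fun i => al - u + i%:R)); apply: eq_bigr => i _.
  by rewrite /y; ring.
have s0 : (-1) ^+ n * (-1) ^+ n = 1 :> R by rewrite -expr2 sqrr_sign.
have wx i : w != x i.
  by rewrite gt_eqF// (le_lt_trans _ w0)// oppr_le0.
have wmu : w != - mu by rewrite gt_eqF//; lra.
have xmu i : x i != - mu.
  by rewrite eqr_opp eq_sym mun// -ltnS.
have nal : n%:R + al != 0 by rewrite gt_eqF//; lra.
have n1 : n%:R + 1 != 0 :> R by rewrite gt_eqF//; lra.
have wx0 : poch w n.+1 != 0.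
  by apply: poch_neq0 => j _; rewrite gt_eqF// ltr_wpDr.
(* This equation dictates [b]: the two signs multiply to -1, and [b (n + 1) (n + al) (mu + al)_{n+1}
   = (-mu)_{n+1} / 2]. *)
have root_mu : 1 / 2 * \prod_i (- mu - x i) + (-1) ^+ n * b *
    ((n%:R + 1) * (n%:R + al)) * \prod_i (- mu - y i) = 0.
  rewrite prodx prody opprK (addrC al mu) /b exprS.
  (* The sign becomes a variable [s] of which only [s * s = 1] is kept. *)
  move: ((-1) ^+ n) s0 => s s0.
  transitivity (poch (- mu) n.+1 / 2 * (1 - s * s)).
    by field; rewrite M0 n1 nal.
  by rewrite s0 subrr mulr0.
have := partial_fraction_shifted xI wx wmu xmu root_mu.
rewrite prodx prody => pf.
(* The sign coming from the zeros [y] is absorbed when [(w)_{n+1}] is rewritten as [(-n - w)_{n+1}]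
   by [poch_oppD]. *)
transitivity (1 / 2 / (w + mu) + (-1) ^+ n * b *
    ((w + mu + (n%:R + 1) * (n%:R + al)) / (w + mu) *
     ((-1) ^+ n.+1 * poch (al - w) n.+1 / poch w n.+1) - 1)); last first.
  by rewrite poch_oppD invfM invr_sign; ring.
rewrite pf; apply: eq_bigr => i _; congr (_ / _); last by rewrite opprK.
have lein : (i <= n)%N by rewrite -ltnS.
have := terminating_hyp_coef lein al0 M0 mun mu0; rewrite -/L -/b => ce.
have mui : mu - i%:R != 0 by rewrite subr_eq0 mun.
pose D : R := \prod_(j < n.+1 | j != i :> nat) (j%:R - i%:R).
have D0 : D != 0.
  by apply/prodf_neq0 => j ji; rewrite subr_eq0 eqr_nat.
apply: (mulIf mui); apply: (mulIf D0); rewrite ce.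
have -> : \prod_(j | j != i) (x i - x j) = D.
  by apply: eq_bigr => j _; rewrite /x opprK addrC.
rewrite -/D; move: D D0 => D D0.
rewrite prody /x opprK exprS (addrC (- i%:R) mu) /L.
move: (poch (al + i%:R) n.+1) ((-1) ^+ n) s0 (b : R) => P s s0 b'.
transitivity (- (s * s) * b' * (mu - i%:R + (n%:R + 1) * (n%:R + al)) * P).
  by rewrite s0; ring.
by field; rewrite mui D0.
Qed.

(** * The polynomial [fmn] as an explicit sum, and its integral *)

Lemma fmn_sum (R : realType) (e m n : nat) (t : R)
    (al := 1 / 2 + e%:R) (mu := m%:R + 1 / 2)
    (L := - ((n%:R + 1) * (n%:R + al) + mu)) :
  fmn e m n t = \sum_(i < n.+1)
    poch al n * - L * poch (1 - mu) n / (poch (mu + al) n.+1 * (n.+1)`!%:R) *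
    ((poch (- n%:R) i * poch (L + 1) i * poch (- mu) i *
      poch (n%:R + 1 + al) i) /
     (poch al i * poch L i * poch (1 - mu) i * i`!%:R)) * t ^+ (e + i.*2).
Proof.
rewrite /fmn hyp_terminating mulrA mulr_sumr; apply: eq_bigr => i _.
rewrite /hyp_term !big_cons !big_nil -exprM mul2n exprD.
(* The quadratic parameters factor through [(n + 1) (n + al) + mu = n^2 + (3/2 + e) n + m + 1 + e],
   which is [- L]. *)
have -> : - n%:R ^+ 2 - (3 / 2 + e%:R) * n%:R - m%:R - e%:R = L + 1.
  by rewrite /L /al /mu; field.
have -> : - n%:R ^+ 2 - (3 / 2 + e%:R) * n%:R - m%:R - 1 - e%:R = L.
  by rewrite /L /al /mu; field.
have -> : n%:R ^+ 2 + (3 / 2 + e%:R) * n%:R + m%:R + 1 + e%:R = - L.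
  by rewrite /L /al /mu; field.
have -> : - m%:R - 1 / 2 = - mu by rewrite /mu; field.
have -> : - m%:R + 1 / 2 = 1 - mu by rewrite /mu; field.
have -> : m%:R + 1 + e%:R = mu + al by rewrite /mu /al; field.
have -> : n%:R + 3 / 2 + e%:R = n%:R + 1 + al by rewrite /al; field.
by rewrite !mulr1 !mulrA; ring.
Qed.

Theorem lemma9 (R : realType) (n m e : nat) (hn : (1 <= n)%N)
    (he : e = 0%N \/ e = 1%N) (z : R) (hz : 0 < z) :
  (\int[@lebesgue_measure R]_(t in `[0%R, 1%R]) (t `^ (z - 1) * fmn e m n t)%:E)%E
  = (1 / (z + 2 * m%:R + 1 + e%:R)
     + (-1) ^+ n.+1 *
       (poch (- m%:R - 1 / 2) n.+1 /
        (poch (m%:R + 1 + e%:R) n.+1 * (n%:R + 1) * (2 * n%:R + 1 + 2 * e%:R)))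
     + (-1) ^+ n *
       (((z + e%:R) / 2 + m%:R + 1 / 2 + (n%:R + 1) * (n%:R + 1 / 2 + e%:R)) /
        (((z + e%:R) / 2 + m%:R + 1 / 2) * (n%:R + 1) * (2 * n%:R + 1 + 2 * e%:R))) *
       ((poch (- m%:R - 1 / 2) n.+1 * poch (- ((z - e%:R) / 2) + 1 / 2) n.+1) /
        (poch (m%:R + 1 + e%:R) n.+1 * poch (- n%:R - (z + e%:R) / 2) n.+1)))%:E.
Proof.
pose al : R := 1 / 2 + e%:R; pose mu : R := m%:R + 1 / 2.
pose w := (z + e%:R) / 2.
have e0 : 0 <= e%:R :> R := ler0n _ e.
have m0 : 0 <= m%:R :> R := ler0n _ m.
have n0 : 0 <= n%:R :> R := ler0n _ n.
have al0 : 0 < al by rewrite /al; lra.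
have mu0 : 0 < mu by rewrite /mu; lra.
have w0 : 0 < w by rewrite /w; lra.
have mun j : (j <= n)%N -> mu != j%:R.
  (* Doubling [mu = j] would equate the odd number [2 m + 1] with the even number [2 j]. *)
  move=> _; apply/eqP => muE; have /eqP : (m.*2.+1)%:R = (j.*2)%:R :> R.
    by rewrite -natr1 -!mul2n !natrM -muE /mu; field.
  by rewrite eqr_nat => /eqP/(congr1 odd); rewrite /= !odd_double.
under eq_integral do rewrite fmn_sum.
rewrite integral_powR_polynomial//; congr EFin.
apply: (etrans _ (etrans (terminating_hyp_partial_fraction al0 mu0 w0 mun) _)).
  apply: eq_bigr => i _.
  (* The exponent [e + 2 i] integrates to [1 / (2 (w + i))], the source of the factor [1 / 2] in the
     coefficients. *)
  have -> : z + (e + i.*2)%:R = 2 * (w + i%:R).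
    by rewrite natrD -mul2n natrM /w; field.
  by rewrite [(2 * (w + _))^-1]invfM !mulrA.
have -> : - m%:R - 1 / 2 = - mu by rewrite /mu; field.
have -> : m%:R + 1 + e%:R = mu + al by rewrite /mu /al; field.
have -> : - ((z - e%:R) / 2) + 1 / 2 = al - w by rewrite /al /w; field.
rewrite -/w.
have -> : z + 2 * m%:R + 1 + e%:R = 2 * (w + mu) by rewrite /w /mu; field.
have -> : w + m%:R + 1 / 2 = w + mu by rewrite /mu addrA.
have -> : 2 * n%:R + 1 + 2 * e%:R = 2 * (n%:R + al) by rewrite /al; field.
have -> : n%:R + 1 / 2 + e%:R = n%:R + al by rewrite /al addrA.
rewrite exprS !mul1r !invfM.
by ring.
Qed.
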